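(* Let $X_Q=V(r^2-qs)\subset\mathbb{C}^4$ and for $d\in\mathbb{N}$ let $g_d:X_Q\to X_Q$ be the Chebyshev-induced morphism on $\mathbb{C}^3/D_4\simeq X_Q$. Let $G_X:\mathbb{C}^3\to X_Q$ be $$G_X(u,v,w)=\Bigl(v^2+uvw+w^2,\ (u+vw)^2,\ (u+vw)\bigl(2vw+\tfrac12u(v^2+w^2)\bigr),\ \bigl(2vw+\tfrac12u(v^2+w^2)\bigr)^2\Bigr).$$ (1) $g_d(G_X(u,v,w))=G_X(T_d(u),T_d(v),T_d(w))$ for all $u,v,w\in\mathbb{C}$. (2) For $d\ge2$, $K(g_d|_{X_Q})=\{G_X(2\cos2\alpha,\,2\cos(\alpha+\beta),\,2\cos\gamma):0\le\alpha,\beta,\gamma<2\pi\}$.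
   Context: $\mathbb{N}=\{1,2,\dots\}$. $T_d(z)$ is the one-variable Chebyshev polynomial with $T_d(s+s^{-1})=s^d+s^{-d}$. Definition of $g_d$: the Chebyshev endomorphism $P_{A_3}^d:\mathbb{C}^3\to\mathbb{C}^3$ is defined by $P_{A_3}^d(e_1(t),e_2(t),e_3(t))=(e_1(t^d),e_2(t^d),e_3(t^d))$ for $t=(t_1,t_2,t_3,t_4)\in(\mathbb{C}^* )^4$ with $t_1t_2t_3t_4=1$, where $t^d=(t_1^d,\dots,t_4^d)$ and $e_j$ is the $j$-th elementary symmetric polynomial. With $M_3(x,y,z)=(x+iy,\,z,\,x-iy)$ put $f_d=M_3^{-1}\circ P_{A_3}^d\circ M_3$. $D_4\subset GL(3,\mathbb{R})$ is the dihedral group of order 8 generated by $(x,y,z)\mapsto(-y,x,-z)$ and $(x,y,z)\mapsto(x,-y,z)$. The map $\tilde F(x,y,z)=(x^2+y^2,\,z^2,\,z(x^2-y^2),\,(x^2-y^2)^2)$ from $\mathbb{C}^3$ onto $X_Q$ (coordinates $(p,q,r,s)$) induces a bijection $\mathbb{C}^3/D_4\simeq X_Q$, and $g_d:X_Q\to X_Q$ is the unique map with $g_d\circ\tilde F=\tilde F\circ f_d$ (it is a morphism). $K(g_d|_{X_Q})$ is the set of $w\in X_Q$ whose forward orbit $\{g_d^k(w):k=1,2,\dots\}$ is bounded in $\mathbb{C}^4$. *)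

(* Defs.v *)
From HB Require Import structures.
From mathcomp Require Import all_boot all_order all_algebra.
From mathcomp Require Import all_classical all_reals all_analysis.
From mathcomp Require Import complex.
From mathcomp Require Import ring.

Set Implicit Arguments.
Unset Strict Implicit.
Unset Printing Implicit Defensive.

Import Order.TTheory GRing.Theory Num.Theory.
Import numFieldNormedType.Exports.

Local Open Scope classical_set_scope.
Local Open Scope ring_scope.

Section Algebra.
Variable C : numClosedFieldType.
Implicit Types (d : nat) (s x y z : C) (c v : C * C * C) (t : C * C * C * C).

Lemma chebT_exists d :
  exists T : {poly C}, forall s, s != 0 -> T.[s + s^-1] = s ^+ d + s ^- d.
Proof.
suff [T [_ [hT _]]] : exists T U : {poly C},
    (forall s, s != 0 -> T.[s + s^-1] = s ^+ d + s ^- d) /\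
    (forall s, s != 0 -> U.[s + s^-1] = s ^+ d.+1 + s ^- d.+1).
  by exists T.
elim: d => [|d [T [U [hT hU]]]].
  exists 2%:P, 'X; split=> s s0; first by rewrite hornerC expr0 invr1.
  by rewrite hornerX !expr1.
exists U, ('X * U - T); split=> // s s0.
rewrite !hornerE hT // hU // -!exprVn !exprS.
have h : s * s^-1 = 1 by rewrite divff.
move: (s ^+ d) (s^-1 ^+ d) h => a b h.
transitivity (s * (s * a) + s^-1 * (s^-1 * b)
              + (s * s^-1 - 1) * (a + b)); first by ring.
by rewrite h subrr mul0r addr0.
Qed.

Definition chebT d : {poly C} := sval (cid (chebT_exists d)).

Lemma chebTE d s : s != 0 -> (chebT d).[s + s^-1] = s ^+ d + s ^- d.
Proof. by move: s; rewrite /chebT; case: cid. Qed.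

Lemma joukowski_surj x : exists2 s, s != 0 & x = s + s^-1.
Proof.
pose s := (x + sqrtC (x ^+ 2 - 4)) / 2.
have hs : s * (x - s) = 1.
  rewrite /s; have := sqrtCK (x ^+ 2 - 4); move: (sqrtC _) => q hq.
  have -> : (x + q) / 2 * (x - (x + q) / 2) = (x ^+ 2 - q ^+ 2) / 4 by field.
  by rewrite hq; field.
have s0 : s != 0.
  by apply/eqP => h; move/eqP: hs; rewrite h mul0r eq_sym oner_eq0.
exists s => //.
by apply: (addrI (- s)); rewrite addKr addrC; apply: (mulfI s0); rewrite hs divff.
Qed.

Lemma chebT_unique d (T : {poly C}) :
  (forall s, s != 0 -> T.[s + s^-1] = s ^+ d + s ^- d) -> T = chebT d.
Proof.
move=> hT; apply/eqP; rewrite -subr_eq0; set p := T - _.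
have hp x : root p x.
  have [s s0 ->] := joukowski_surj x.
  by rewrite /root /p !hornerE hT // chebTE // subrr.
apply/negPn/negP => p0.
have hu : uniq [seq i%:R : C | i <- iota 0 (size p)].
  by rewrite map_inj_uniq ?iota_uniq // => i j /eqP; rewrite eqr_nat => /eqP.
have ha : all (root p) [seq i%:R : C | i <- iota 0 (size p)].
  by apply/allP => x _.
by have := max_poly_roots p0 ha hu; rewrite size_map size_iota ltnn.
Qed.

Definition esym4 t : C * C * C :=
  let: (t1, t2, t3, t4) := t in
  (t1 + t2 + t3 + t4,
   t1 * t2 + t1 * t3 + t1 * t4 + t2 * t3 + t2 * t4 + t3 * t4,
   t1 * t2 * t3 + t1 * t2 * t4 + t1 * t3 * t4 + t2 * t3 * t4).

Definition prod4 t : C := let: (t1, t2, t3, t4) := t in t1 * t2 * t3 * t4.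

Definition pow4 d t : C * C * C * C :=
  let: (t1, t2, t3, t4) := t in (t1 ^+ d, t2 ^+ d, t3 ^+ d, t4 ^+ d).

Definition seq4 t : seq C := let: (t1, t2, t3, t4) := t in [:: t1; t2; t3; t4].

Definition quartic c (m : C) : {poly C} :=
  'X^4 - (c.1.1)%:P * 'X^3 + (c.1.2)%:P * 'X^2 - (c.2)%:P * 'X + m%:P.

Lemma quartic_roots t :
  \prod_(x <- seq4 t) ('X - x%:P) = quartic (esym4 t) (prod4 t).
Proof.
case: t => [[[a b] c] e]; rewrite /quartic /= !big_cons big_nil.
rewrite !(polyCD, polyCM); ring.
Qed.

Lemma quartic_inj c c' m m' : quartic c m = quartic c' m' -> c = c'.
Proof.
case: c c' => [[a b] e] [[a' b'] e']; rewrite /quartic /= => h.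
have h3 := congr1 (fun p : {poly C} => p`_3) h.
have h2 := congr1 (fun p : {poly C} => p`_2) h.
have h1 := congr1 (fun p : {poly C} => p`_1) h.
move: h1 h2 h3; rewrite !(coefD, coefN, coefCM, coefXn, coefX, coefC) /=.
rewrite !(mulr0, mulr1, oppr0, addr0, add0r).
by move=> /oppr_inj -> -> /oppr_inj ->.
Qed.

Lemma quartic_split c (m : C) : exists t, quartic c m = \prod_(x <- seq4 t) ('X - x%:P).
Proof.
have hsz : size (quartic c m) = 5%N.
  rewrite /quartic -!addrA size_polyDl ?size_polyXn //.
  apply: (leq_ltn_trans (_ : _ <= 4)%N) => //.
  apply/leq_sizeP => j hj.
  rewrite !(coefD, coefN, coefCM, coefXn, coefX, coefC).
  by case: j hj => [|[|[|[|j]]]] //= _; rewrite !(mulr0, oppr0, addr0).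
have hl : lead_coef (quartic c m) = 1.
  rewrite lead_coefE hsz /quartic !(coefD, coefN, coefCM, coefXn, coefX, coefC) /=.
  by rewrite !(mulr0, oppr0, addr0).
have [r hr] := closed_field_poly_normal (quartic c m).
move: hr; rewrite hl scale1r => hr.
have : size r = 4%N by apply: succn_inj; rewrite -hsz hr size_prod_XsubC.
case: r hr => [|t1 [|t2 [|t3 [|t4 [|? ?]]]]] //= -> _.
by exists (t1, t2, t3, t4).
Qed.

Lemma esym4_surj c : exists2 t, prod4 t = 1 & c = esym4 t.
Proof.
have [t ht] := quartic_split c 1; exists t.
  have := congr1 (fun p : {poly C} => p`_0) ht; rewrite quartic_roots /quartic.
  rewrite !(coefD, coefN, coefCM, coefXn, coefX, coefC) /=.
  by rewrite !(mulr0, oppr0, addr0, add0r).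
by apply: (@quartic_inj _ _ 1 (prod4 t)); rewrite ht quartic_roots.
Qed.

Lemma esym4_pow d t t' : prod4 t = prod4 t' -> esym4 t = esym4 t' ->
  esym4 (pow4 d t) = esym4 (pow4 d t').
Proof.
move=> hp he.
have hpe : perm_eq (seq4 t) (seq4 t').
  by apply: prod_XsubC_eq; rewrite !quartic_roots hp he.
have hs u : seq4 (pow4 d u) = [seq x ^+ d | x <- seq4 u].
  by case: u => [[[? ?] ?] ?].
apply: (@quartic_inj _ _ (prod4 (pow4 d t)) (prod4 (pow4 d t'))).
by rewrite -!quartic_roots; apply: perm_big; rewrite !hs; apply: perm_map.
Qed.

Lemma PA3_exists d : exists P : C * C * C -> C * C * C,
  forall t, prod4 t = 1 -> P (esym4 t) = esym4 (pow4 d t).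
Proof.
exists (fun c => esym4 (pow4 d (s2val (cid2 (esym4_surj c))))) => t ht.
by case: cid2 => t' ht' he /=; apply: esym4_pow; rewrite // ht ht'.
Qed.

(* [prod4 t = 1] already forces the four entries of [t] to be nonzero. *)
Definition PA3 d : C * C * C -> C * C * C := sval (cid (PA3_exists d)).

Lemma PA3E d t : prod4 t = 1 -> PA3 d (esym4 t) = esym4 (pow4 d t).
Proof. by move: t; rewrite /PA3; case: cid. Qed.

Lemma PA3_unique d (P : C * C * C -> C * C * C) :
  (forall t, prod4 t = 1 -> P (esym4 t) = esym4 (pow4 d t)) -> P = PA3 d.
Proof.
by move=> hP; apply/funext => c; have [t ht ->] := esym4_surj c; rewrite hP // PA3E.
Qed.

Definition M3 v : C * C * C := let: (x, y, z) := v in (x + 'i * y, z, x - 'i * y).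

Definition M3inv c : C * C * C :=
  let: (a, b, e) := c in ((a + e) / 2, (a - e) / (2 * 'i), b).

Lemma i_neq0 : ('i : C) != 0.
Proof. exact: neq0Ci. Qed.

Lemma M3K : cancel M3 M3inv.
Proof.
move=> [[x y] z]; rewrite /M3inv /M3; congr (_, _, _); first by field.
by field; rewrite i_neq0.
Qed.

Lemma M3invK : cancel M3inv M3.
Proof.
move=> [[a b] e]; rewrite /M3inv /M3; congr (_, _, _).
  by field; rewrite i_neq0.
by field; rewrite i_neq0.
Qed.

Definition fd d : C * C * C -> C * C * C := M3inv \o PA3 d \o M3.

Definition D4_rot v : C * C * C := let: (x, y, z) := v in (- y, x, - z).
Definition D4_refl v : C * C * C := let: (x, y, z) := v in (x, - y, z).

(* Being in the same orbit of the group generated by [D4_rot] and [D4_refl];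
   both have finite order, so inverses of the generators are not needed. *)
Inductive D4_orbit v : C * C * C -> Prop :=
| D4_orbit_id : D4_orbit v v
| D4_orbit_rot v' : D4_orbit v v' -> D4_orbit v (D4_rot v')
| D4_orbit_refl v' : D4_orbit v v' -> D4_orbit v (D4_refl v').

Definition in_XQ (w : C * C * C * C) : bool :=
  let: (p, q, r, s) := w in r ^+ 2 - q * s == 0.

Definition XQ := {w : C * C * C * C | in_XQ w}.

Lemma Ftilde_subproof x y z :
  (z * (x ^+ 2 - y ^+ 2)) ^+ 2 - z ^+ 2 * (x ^+ 2 - y ^+ 2) ^+ 2 == 0.
Proof. by rewrite exprMn subrr. Qed.

Definition Ftilde v : XQ :=
  let: (x, y, z) := v in
  exist _ (x ^+ 2 + y ^+ 2, z ^+ 2, z * (x ^+ 2 - y ^+ 2), (x ^+ 2 - y ^+ 2) ^+ 2)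
    (Ftilde_subproof x y z).

Lemma Ftilde_surj (w : XQ) : exists v, Ftilde v = w.
Proof.
case: w => -[[[p q] r] s] hw.
have hr : r ^+ 2 = q * s by apply/eqP; rewrite -subr_eq0.
have [z [A [hz hA hzA]]] :
    exists z A : C, [/\ z ^+ 2 = q, A ^+ 2 = s & z * A = r].
  have [q0|q0] := eqVneq q 0.
    exists 0, (sqrtC s); split; rewrite ?sqrtCK ?expr0n ?q0 ?mul0r //.
    by move/eqP: hr; rewrite q0 mul0r sqrf_eq0 => /eqP.
  have z0 : sqrtC q != 0 by rewrite sqrtC_eq0.
  exists (sqrtC q), (r / sqrtC q); split; first exact: sqrtCK.
    by rewrite expr_div_n sqrtCK hr mulrC mulKf.
  by rewrite mulrC divfK.
exists (sqrtC ((p + A) / 2), sqrtC ((p - A) / 2), z).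
apply: val_inj => /=; rewrite !sqrtCK hz.
have -> : (p + A) / 2 - (p - A) / 2 = A by field.
have -> : (p + A) / 2 + (p - A) / 2 = p by field.
by rewrite hzA hA.
Qed.

Lemma Ftilde_rot v : Ftilde (D4_rot v) = Ftilde v.
Proof.
case: v => [[x y] z]; apply: val_inj => /=.
by congr (_, _, _, _); ring.
Qed.

Lemma Ftilde_refl v : Ftilde (D4_refl v) = Ftilde v.
Proof. by case: v => [[x y] z]; apply: val_inj => /=; rewrite sqrrN. Qed.

Lemma D4_orbit_trans v1 v2 v3 : D4_orbit v1 v2 -> D4_orbit v2 v3 -> D4_orbit v1 v3.
Proof.
by move=> h; elim=> // v' _ ih; [apply: D4_orbit_rot | apply: D4_orbit_refl].
Qed.

Lemma D4_orbit_sign x y z x' y' : x' ^+ 2 = x ^+ 2 -> y' ^+ 2 = y ^+ 2 ->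
  D4_orbit (x, y, z) (x', y', z).
Proof.
have hr a b e : D4_orbit (a, b, e) (a, - b, e).
  exact: (D4_orbit_refl (D4_orbit_id _)).
have hn a b e : D4_orbit (a, b, e) (- a, - b, e).
  have := D4_orbit_rot (D4_orbit_rot (D4_orbit_id (a, b, e))).
  by rewrite /= opprK.
move=> /eqP; rewrite eqf_sqr => /orP hx /eqP; rewrite eqf_sqr => /orP hy.
case: hx hy => /eqP -> [] /eqP ->; first exact: D4_orbit_id.
- exact: hr.
- by apply: D4_orbit_trans (hr _ _ _) _; have := hn x (- y) z; rewrite opprK.
- exact: hn.
Qed.

Lemma Ftilde_fiber v v' : Ftilde v = Ftilde v' <-> D4_orbit v v'.
Proof.
split; last first.
  by elim=> // w _ ->; rewrite ?Ftilde_rot ?Ftilde_refl.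
have key x y z x' y' : x' ^+ 2 + y' ^+ 2 = x ^+ 2 + y ^+ 2 ->
    x' ^+ 2 - y' ^+ 2 = x ^+ 2 - y ^+ 2 -> D4_orbit (x, y, z) (x', y', z).
  move=> h1 h2; apply: D4_orbit_sign.
    have -> : x' ^+ 2 = ((x' ^+ 2 + y' ^+ 2) + (x' ^+ 2 - y' ^+ 2)) / 2 by field.
    by rewrite h1 h2; field.
  have -> : y' ^+ 2 = ((x' ^+ 2 + y' ^+ 2) - (x' ^+ 2 - y' ^+ 2)) / 2 by field.
  by rewrite h1 h2; field.
have same x y z x' y' : Ftilde (x, y, z) = Ftilde (x', y', z) ->
    D4_orbit (x, y, z) (x', y', z).
  move=> /(congr1 val) /= [h1 h2 h3].
  have [z0|z0] := eqVneq z 0; last by apply: key => //; apply: (mulfI z0).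
  move/eqP: h3; rewrite eq_sym eqf_sqr => /orP[] /eqP h; first exact: key.
  apply: (@D4_orbit_trans _ (D4_rot (x, y, z))).
    exact/D4_orbit_rot/D4_orbit_id.
  rewrite /= z0 oppr0; apply: key; first by rewrite -h1; ring.
  by rewrite h; ring.
case: v v' => [[x y] z] [[x' y'] z'] h.
have : z' ^+ 2 = z ^+ 2 by move/(congr1 val): h => /= [_ ->].
move/eqP; rewrite eqf_sqr => /orP[] /eqP hz; rewrite {}hz in h *; first exact: same.
apply: (@D4_orbit_trans _ (D4_rot (x, y, z))).
  exact/D4_orbit_rot/D4_orbit_id.
by apply: same; rewrite -h -(Ftilde_rot (x, y, z)).
Qed.

Lemma Ftilde_M3inv_mu4 (j a b e : C) : j ^+ 4 = 1 ->
  Ftilde (M3inv (j * a, j ^+ 2 * b, j ^+ 3 * e)) = Ftilde (M3inv (a, b, e)).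
Proof.
move=> hj; apply: val_inj; rewrite /M3inv /=.
have i0 := i_neq0.
have sq (u w : C) : ((u - w) / (2 * 'i)) ^+ 2 = - (u - w) ^+ 2 / 4.
  by rewrite expr_div_n exprMn sqrCi; field.
rewrite !sq.
have E (k l : C) : k = j ^+ 4 * l -> k = l by move=> ->; rewrite hj mul1r.
congr (_, _, _, _).
- by apply: E; field.
- by apply: E; ring.
- transitivity (j ^+ 4 * b * (a ^+ 2 + j ^+ 4 * e ^+ 2) / 2); first by field.
  by rewrite hj; field.
- transitivity (j ^+ 4 * ((a ^+ 2 + j ^+ 4 * e ^+ 2) / 2) ^+ 2); first by field.
  by rewrite hj; field.
Qed.

Lemma PA3_mu4 d (j a b e : C) : j ^+ 4 = 1 ->
  PA3 d (j * a, j ^+ 2 * b, j ^+ 3 * e) =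
  (j ^+ d * (PA3 d (a, b, e)).1.1, (j ^+ d) ^+ 2 * (PA3 d (a, b, e)).1.2,
   (j ^+ d) ^+ 3 * (PA3 d (a, b, e)).2).
Proof.
move=> hj; have [[[[t1 t2] t3] t4] ht he] := esym4_surj (a, b, e).
rewrite he PA3E //; move: he => [-> -> ->].
pose t' : C * C * C * C := (j * t1, j * t2, j * t3, j * t4).
have ht' : prod4 t' = 1.
  rewrite /t' /=; transitivity (j ^+ 4 * (t1 * t2 * t3 * t4)); first by ring.
  by rewrite hj mul1r.
transitivity (PA3 d (esym4 t')).
  by congr (PA3 d _); rewrite /t' /=; congr (_, _, _); ring.
by rewrite PA3E // /t' /= !exprMn; congr (_, _, _); ring.
Qed.

Lemma PA3_swap d (a b e : C) :
  PA3 d (e, b, a) =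
  ((PA3 d (a, b, e)).2, (PA3 d (a, b, e)).1.2, (PA3 d (a, b, e)).1.1).
Proof.
have [[[[t1 t2] t3] t4] ht he] := esym4_surj (a, b, e).
rewrite he PA3E //; move: he => [-> -> ->].
have swap (x y z w : C) : x * y * z * w = 1 ->
    esym4 (y * z * w, x * z * w, x * y * w, x * y * z) =
    ((esym4 (x, y, z, w)).2, (esym4 (x, y, z, w)).1.2, (esym4 (x, y, z, w)).1.1).
  move=> h /=; congr (_, _, _); first by ring.
    transitivity (x * y * z * w *
      (x * y + x * z + x * w + y * z + y * w + z * w)); first by ring.
    by rewrite h mul1r.
  transitivity ((x * y * z * w) ^+ 2 * (x + y + z + w)); first by ring.
  by rewrite h expr1n mul1r.
move: (ht) => /= /swap /= <-.
rewrite -[LHS]/(PA3 d (esym4 (t2 * t3 * t4, t1 * t3 * t4, t1 * t2 * t4, t1 * t2 * t3))).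
rewrite PA3E /=; last first.
  move: ht => /= ht; transitivity ((t1 * t2 * t3 * t4) ^+ 3); first by ring.
  by rewrite ht expr1n.
rewrite !exprMn; apply: (swap (t1 ^+ d) (t2 ^+ d) (t3 ^+ d) (t4 ^+ d)).
by move: ht => /= ht; rewrite -!exprMn ht expr1n.
Qed.

Lemma Ftilde_fd_rot d v : Ftilde (fd d (D4_rot v)) = Ftilde (fd d v).
Proof.
have i4 : ('i : C) ^+ 4 = 1 by rewrite (exprM 'i 2 2) sqrCi sqrrN expr1n.
have i2 : ('i : C) * 'i = -1 by rewrite -expr2 sqrCi.
rewrite /fd [in LHS]/comp [in RHS]/comp.
have -> : M3 (D4_rot v) = ('i * (M3 v).1.1, 'i ^+ 2 * (M3 v).1.2, 'i ^+ 3 * (M3 v).2).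
  case: v => [[x y] z] /=; congr (_, _, _).
  - by rewrite mulrDr mulrA i2; ring.
  - by rewrite sqrCi mulN1r.
  - transitivity ('i * 'i * ('i * x) - ('i * 'i) * ('i * 'i) * y); last by ring.
    by rewrite i2; ring.
case: (M3 v) => [[a b] e]; rewrite [_.1.1]/= [_.1.2]/= [_.2]/= PA3_mu4 //.
case: (PA3 d (a, b, e)) => [[a' b'] e']; apply: Ftilde_M3inv_mu4.
by rewrite exprAC i4 expr1n.
Qed.

Lemma Ftilde_fd_refl d v : Ftilde (fd d (D4_refl v)) = Ftilde (fd d v).
Proof.
rewrite -(Ftilde_refl (fd d v)); congr Ftilde; rewrite /fd /comp.
have -> : M3 (D4_refl v) = ((M3 v).2, (M3 v).1.2, (M3 v).1.1).
  by case: v => [[x y] z] /=; rewrite mulrN opprK.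
case: (M3 v) => [[a b] e]; rewrite [_.1.1]/= [_.1.2]/= [_.2]/= PA3_swap.
case: (PA3 d (a, b, e)) => [[a' b'] e'] /=.
by rewrite [e' + _]addrC -mulNr opprB.
Qed.

Lemma gd_exists d : exists g : XQ -> XQ, g \o Ftilde = Ftilde \o fd d.
Proof.
exists (fun w => Ftilde (fd d (sval (cid (Ftilde_surj w))))).
apply/funext => v /=; case: cid => v' /= /Ftilde_fiber.
by elim=> // w _ ->; rewrite ?Ftilde_fd_rot ?Ftilde_fd_refl.
Qed.

Definition gd d : XQ -> XQ := sval (cid (gd_exists d)).

Lemma gdE d : gd d \o Ftilde = Ftilde \o fd d.
Proof. by rewrite /gd; case: cid. Qed.

Lemma gd_unique d (g : XQ -> XQ) : g \o Ftilde = Ftilde \o fd d -> g = gd d.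
Proof.
rewrite -gdE => h; apply/funext => w; have [v <-] := Ftilde_surj w.
exact: (congr1 (@^~ v) h).
Qed.

Lemma GX_subproof (u v w : C) :
  ((u + v * w) * (2 * v * w + 2^-1 * u * (v ^+ 2 + w ^+ 2))) ^+ 2
  - (u + v * w) ^+ 2 * (2 * v * w + 2^-1 * u * (v ^+ 2 + w ^+ 2)) ^+ 2 == 0.
Proof. by rewrite exprMn subrr. Qed.

Definition GX (u v w : C) : XQ :=
  exist _
    (v ^+ 2 + u * v * w + w ^+ 2,
     (u + v * w) ^+ 2,
     (u + v * w) * (2 * v * w + 2^-1 * u * (v ^+ 2 + w ^+ 2)),
     (2 * v * w + 2^-1 * u * (v ^+ 2 + w ^+ 2)) ^+ 2)
    (GX_subproof u v w).

Definition bounded_orbits (g : XQ -> XQ) : set XQ :=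
  [set w | bounded_set [set sval (iter k g w) | k in [set k | (0 < k)%N]]].

End Algebra.

(* Main.v *)
(** A triple of Chebyshev arguments [u = x^2 + x^-2], [v = b + b^-1],
    [w = c + c^-1] corresponds to the point
    [t = (x b, x / b, c / x, 1 / (x c))] of the A_3 torus (the isomorphism
    A_3 = D_3 of root systems): [G_X (u, v, w)] is the image of [t] in
    [C^3 / D_4], and every point of the torus has this form.  On the torus [g_d]
    acts by [t |-> t^d], which gives (1).  If an orbit is bounded then so are
    the elementary symmetric functions of [t^(d^k)], hence its entries by
    Cauchy's root bound; thus all entries of [t] have modulus at most 1, and
    exactly 1 since their product is 1. *)

Require Import Defs.
From mathcomp Require Import all_boot all_order all_algebra.
From mathcomp Require Import all_classical all_reals all_analysis.
From mathcomp Require Import complex ring lra.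

Set Implicit Arguments.
Unset Strict Implicit.
Unset Printing Implicit Defensive.

Import Order.TTheory GRing.Theory Num.Theory.
Local Open Scope classical_set_scope.
Local Open Scope complex_scope.
Local Open Scope ring_scope.

(** * The A_3 torus, its [spin_torus] coordinates, and part (1) *)

Section TorusParametrization.
Variable C : numClosedFieldType.
Implicit Types (d k : nat) (t : C * C * C * C) (x y z b c : C).

Definition Ftilde_esym4 t : XQ C := Ftilde (M3inv (esym4 t)).

Lemma prod4_pow4 d t : prod4 t = 1 -> prod4 (pow4 d t) = 1.
Proof. by case: t => [[[a b] c] e] /= h; rewrite -!exprMn h expr1n. Qed.

Lemma pow4M d k t : pow4 k (pow4 d t) = pow4 (d * k) t.
Proof. by case: t => [[[a b] c] e] /=; rewrite -!exprM. Qed.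

Lemma gd_Ftilde_esym4 d t : prod4 t = 1 ->
  gd d (Ftilde_esym4 t) = Ftilde_esym4 (pow4 d t).
Proof.
move=> ht; rewrite /Ftilde_esym4 -[LHS]/((gd d \o @Ftilde C) _) gdE /= /fd /=.
by rewrite M3invK PA3E.
Qed.

Lemma iter_gd_Ftilde_esym4 d k t : prod4 t = 1 ->
  iter k (gd d) (Ftilde_esym4 t) = Ftilde_esym4 (pow4 (d ^ k) t).
Proof.
move=> ht; elim: k => [|k /= ->].
  by case: t {ht} => [[[a b] c] e]; rewrite /= !expr1.
by rewrite gd_Ftilde_esym4 ?prod4_pow4 // pow4M -expnSr.
Qed.

(** Since (x, b, c) and (-x, -b, -c) give the same point, this is a double cover of the torus on
    which the product of the first two entries acquires the square root x. *)
Definition spin_torus x b c : C * C * C * C := (x * b, x / b, c / x, (x * c)^-1).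

Lemma prod4_spin_torus x b c : x != 0 -> b != 0 -> c != 0 ->
  prod4 (spin_torus x b c) = 1.
Proof. by move=> x0 b0 c0 /=; field; rewrite x0 b0 c0. Qed.

Lemma pow4_spin_torus d x b c :
  pow4 d (spin_torus x b c) = spin_torus (x ^+ d) (b ^+ d) (c ^+ d).
Proof. by rewrite /spin_torus /= !exprMn !exprVn !exprMn. Qed.

(** With e1 = x + iy and e3 = x - iy one has x^2 + y^2 = e1 e3 and x^2 - y^2 = (e1^2 + e3^2) / 2, so
    the imaginary unit disappears. *)
Lemma Ftilde_M3invE (e1 e2 e3 : C) : val (Ftilde (M3inv (e1, e2, e3))) =
  (e1 * e3, e2 ^+ 2, e2 * ((e1 ^+ 2 + e3 ^+ 2) / 2),
   ((e1 ^+ 2 + e3 ^+ 2) / 2) ^+ 2).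
Proof.
have i0 := @i_neq0 C.
have sq : ((e1 - e3) / (2 * 'i)) ^+ 2 = - (e1 - e3) ^+ 2 / 4.
  by rewrite expr_div_n exprMn sqrCi; field.
by rewrite /= sq; congr (_, _, _, _); field.
Qed.

(** Grouping the torus entries in pairs gives e1 = x v + w / x, e2 = u + v w and e3 = v / x + x w;
    substituting these into [Ftilde_M3invE] produces exactly the polynomials of [GX]. *)
Lemma GX_spin_torus x b c : x != 0 -> b != 0 -> c != 0 ->
  GX (x ^+ 2 + x ^- 2) (b + b^-1) (c + c^-1) = Ftilde_esym4 (spin_torus x b c).
Proof.
move=> x0 b0 c0; apply: val_inj; rewrite /Ftilde_esym4.
pose v := b + b^-1; pose w := c + c^-1.
have -> : esym4 (spin_torus x b c) =
    (x * v + w / x, x ^+ 2 + x ^- 2 + v * w, v / x + x * w).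
  by rewrite /v /w /=; congr (_, _, _); field; rewrite ?x0 ?b0 ?c0.
rewrite Ftilde_M3invE -/v -/w /=.
by congr (_, _, _, _); field; rewrite ?x0.
Qed.

(** The first two entries multiply to x^2, so x must be a square root of t1 t2; b and c are then
    read off from t1 and t3, and the product condition forces t4. *)
Lemma spin_torusP t : prod4 t = 1 ->
  exists x b c, [/\ x != 0, b != 0, c != 0 & t = spin_torus x b c].
Proof.
case: t => [[[t1 t2] t3] t4] /= ht.
have : t1 * t2 * t3 * t4 != 0 by rewrite ht oner_neq0.
rewrite !mulf_eq0 !negb_or -!andbA => /and4P[h1 h2 h3 h4].
have t12 : t1 * t2 != 0 by rewrite mulf_neq0.
pose x := sqrtC (t1 * t2).
have x0 : x != 0 by rewrite sqrtC_eq0.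
have hx : x ^+ 2 = t1 * t2 by rewrite sqrtCK.
exists x, (t1 / x), (t3 * x).
split; rewrite ?mulf_neq0 ?invr_eq0 //.
congr (_, _, _, _).
- by field.
- by apply: (mulfI h1); rewrite -hx; field; rewrite x0 h1.
- by field.
- apply: (mulfI (mulf_neq0 t12 h3)); rewrite ht -hx; field.
  by rewrite x0 h3.
Qed.

Lemma Ftilde_esym4_surj (X : XQ C) : exists2 t, prod4 t = 1 & X = Ftilde_esym4 t.
Proof.
have [v <-] := Ftilde_surj X; have [t ht he] := esym4_surj (M3 v).
by exists t => //; rewrite /Ftilde_esym4 -he M3K.
Qed.

Lemma gd_GX d (u v w : C) :
  gd d (GX u v w) = GX (chebT C d).[u] (chebT C d).[v] (chebT C d).[w].
Proof.
have [s s0 ->] := joukowski_surj u.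
have [b b0 ->] := joukowski_surj v; have [c c0 ->] := joukowski_surj w.
(* The Joukowski parameter s of u plays the role of x^2, so x is taken to be its square root. *)
have x0 : sqrtC s != 0 by rewrite sqrtC_eq0.
rewrite !chebTE // -[s]sqrtCK GX_spin_torus // gd_Ftilde_esym4 ?prod4_spin_torus //.
by rewrite pow4_spin_torus -GX_spin_torus ?expf_neq0 // ![_ ^+ 2 ^+ d]exprAC.
Qed.

(** * Estimates linking orbits in X_Q, symmetric functions and torus entries *)

Lemma esym4_root_le t (M z : C) : prod4 t = 1 -> 1 <= M ->
  `|(esym4 t).1.1| <= M -> `|(esym4 t).1.2| <= M -> `|(esym4 t).2| <= M ->
  z \in seq4 t -> `|z| <= 1 + M.
Proof.
move=> ht M1 h1 h2 h3 hz.
have hroot : z ^+ 4 = (esym4 t).1.1 * z ^+ 3 - (esym4 t).1.2 * z ^+ 2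
    + (esym4 t).2 * z - 1.
  rewrite -ht; move: hz; case: t {ht h1 h2 h3} => [[[t1 t2] t3] t4] /=.
  by rewrite !inE => /or4P[] /eqP ->; ring.
(* The order on C is partial; realness allows the negated inequality to be turned into a strict
   one. *)
have Mr : M \is Num.real by apply: ger1_real.
rewrite real_leNgt ?rpredD ?rpred1 ?normr_real //; apply/negP => hlt.
set n := `|z| in hlt; have n0 : 0 <= n by apply: normr_ge0.
(* The constant term of the quartic has modulus 1, which 1 <= M absorbs into M. *)
have : n ^+ 4 <= M * n ^+ 3 + M * n ^+ 2 + M * n + M.
  rewrite /n -normrX hroot.
  apply: (le_trans (ler_normB _ _)); rewrite normr1 lerD //.
  apply: (le_trans (ler_normD _ _)); rewrite lerD //.
    apply: (le_trans (ler_normB _ _)); rewrite lerD //.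
      by rewrite normrM normrX ler_wpM2r // exprn_ge0.
    by rewrite normrM normrX ler_wpM2r // exprn_ge0.
  by rewrite normrM ler_wpM2r.
(* M < n - 1 makes the right-hand side smaller than (n - 1)(n^3 + n^2 + n + 1) = n^4 - 1, a
   contradiction. *)
have h : M < n - 1 by rewrite ltrBrDl.
have hS : 0 < n ^+ 3 + n ^+ 2 + n + 1 by rewrite ltr_wpDl // !addr_ge0 ?exprn_ge0.
have := h; rewrite -(ltr_pM2r hS) => h' h''.
have : n ^+ 4 < n ^+ 4 - 1.
  have -> : n ^+ 4 - 1 = (n - 1) * (n ^+ 3 + n ^+ 2 + n + 1) by ring.
  apply: le_lt_trans h'; apply: (le_trans h'').
  by rewrite [leRHS](_ : _ = M * n ^+ 3 + M * n ^+ 2 + M * n + M) //; ring.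
by rewrite ltrDl oppr_gt0 ltr10.
Qed.

(* [p], [s] control [(e1 + e3)^2] and [(e1 - e3)^2]. *)
Lemma Ftilde_M3inv_le (e1 e2 e3 N : C) : 1 <= N ->
  (forall w, w \in seq4 (val (Ftilde (M3inv (e1, e2, e3)))) -> `|w| <= N) ->
  [/\ `|e1| <= 4 * N, `|e2| <= 4 * N & `|e3| <= 4 * N].
Proof.
move=> N1; rewrite Ftilde_M3invE => h.
have N0 : 0 <= N by apply: le_trans N1.
(* For L >= 1 a bound L on the square is also a bound on y, because L <= L^2. *)
have sqle (y L : C) : 1 <= L -> `|y ^+ 2| <= L -> `|y| <= L.
  move=> L1; rewrite normrX => hy.
  have L0 : 0 <= L by apply: le_trans L1.
  rewrite -(ler_pXn2r (n := 2)) ?nnegrE //.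
  by apply: (le_trans hy); rewrite expr2 ler_peMl.
have hp := h (e1 * e3); have hq := h (e2 ^+ 2).
have hs := h (((e1 ^+ 2 + e3 ^+ 2) / 2) ^+ 2).
move: hp hq hs; rewrite /= !inE !eqxx ?orbT => /(_ isT) hp /(_ isT) hq /(_ isT) hs.
have {}hs := sqle _ _ N1 hs.
have N4 : 1 <= 4 * N by rewrite mulr_ege1 ?ler1n.
have N4' : N <= 4 * N by rewrite ler_peMl // ler1n.
have hsq : `|(e1 ^+ 2 + e3 ^+ 2)| <= 2 * N.
  by rewrite mulrC -ler_pdivrMr // -[X in _ / X]ger0_norm // -normf_div.
have hm (y : C) : y = e1 + e3 \/ y = e1 - e3 -> `|y| <= 4 * N.
  move=> hy; apply: sqle => //.
  have hp2 : `|2 * (e1 * e3)| <= 2 * N by rewrite normrM normr_nat ler_wpM2l.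
  have -> : 4 * N = 2 * N + 2 * N by ring.
  case: hy => ->.
    have -> : (e1 + e3) ^+ 2 = (e1 ^+ 2 + e3 ^+ 2) + 2 * (e1 * e3) by ring.
    by apply: (le_trans (ler_normD _ _)); rewrite lerD.
  have -> : (e1 - e3) ^+ 2 = (e1 ^+ 2 + e3 ^+ 2) - 2 * (e1 * e3) by ring.
  by apply: (le_trans (ler_normB _ _)); rewrite lerD.
(* Half the sum and half the difference of e1 + e3 and e1 - e3 recover e1 and e3 with the same
   bound. *)
have hplus := hm _ (or_introl erefl); have hminus := hm _ (or_intror erefl).
split.
- rewrite -(ler_pM2l (x := 2)) // -[X in X * `|_|](ger0_norm (x := 2)) // -normrM.
  have -> : 2 * e1 = (e1 + e3) + (e1 - e3) by ring.
  by apply: (le_trans (ler_normD _ _)); rewrite mulrDl mul1r lerD.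
- exact: le_trans (sqle _ _ N1 hq) N4'.
- rewrite -(ler_pM2l (x := 2)) // -[X in X * `|_|](ger0_norm (x := 2)) // -normrM.
  have -> : 2 * e3 = (e1 + e3) - (e1 - e3) by ring.
  by apply: (le_trans (ler_normB _ _)); rewrite mulrDl mul1r lerD.
Qed.


(** The norm of a tuple is the maximum of the component norms; these are real, hence comparable, so
    the maximum behaves as in a total order. *)
Lemma norm_seq4_le t N : reflect {in seq4 t, forall z, `|z| <= N} (`|t| <= N).
Proof.
case: t => [[[a b] c] e]; rewrite !prod_normE /=.
have hr (x y : C) : x \is Num.real -> y \is Num.real ->
    (Num.max x y <= N) = (x <= N) && (y <= N).
  by move=> ? ?; rewrite comparable_ge_max // real_comparable.
rewrite !hr ?max_real ?normr_real //.
apply: (iffP idP) => [/andP[/andP[/andP[ha hb] hc] he] z|h].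
  by rewrite !inE => /or4P[] /eqP ->.
by rewrite !h // !inE eqxx ?orbT.
Qed.

Lemma bounded_orbitsP (g : XQ C -> XQ C) X : bounded_orbits g X <->
  exists2 N : C, 1 <= N & forall k, (0 < k)%N ->
    {in seq4 (val (iter k g X)), forall z, `|z| <= N}.
Proof.
split=> [[M [Mr hM]]|[N N1 hN]].
  (* [bounded_set] provides bounds strictly beyond M only; adding 1 achieves this and also makes the
     bound at least 1. *)
  exists (`|M| + 1); first by rewrite lerDr.
  move=> k k0; apply/norm_seq4_le; apply: (hM (`|M| + 1)); last by exists k.
  by rewrite (le_lt_trans (real_ler_norm Mr)) // ltrDl ltr01.
exists N; split; first exact: ger1_real.
move=> M /ltW NM _ [k k0 <-]; apply: le_trans NM.
by apply/norm_seq4_le; apply: hN.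
Qed.

Lemma norm_unit_DV z : `|z| = 1 -> `|z + z^-1| <= 2.
Proof. by move=> h; rewrite (le_trans (ler_normD _ _)) // normfV h invr1. Qed.

(** The two inner factors are at most 2 + 4 = 6 and 8 + 8 = 16, so the coordinates are at most 16,
    36, 96 and 256. *)
Lemma GX_le (u v w : C) : `|u| <= 2 -> `|v| <= 2 -> `|w| <= 2 ->
  {in seq4 (val (GX u v w)), forall z, `|z| <= 256}.
Proof.
move=> hu hv hw.
have sq (y L : C) : `|y| <= L -> `|y ^+ 2| <= L ^+ 2.
  by move=> h; rewrite normrX lerXn2r // nnegrE // (le_trans _ h).
have mul (y y' L L' : C) : `|y| <= L -> `|y'| <= L' -> `|y * y'| <= L * L'.
  by move=> h h'; rewrite normrM ler_pM.
have add (y y' L L' : C) : `|y| <= L -> `|y'| <= L' -> `|y + y'| <= L + L'.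
  by move=> h h'; rewrite (le_trans (ler_normD _ _)) // lerD.
have h2 : `|2 : C| <= 2 by rewrite normr_nat.
have hi : `|2^-1 : C| <= 2^-1 by rewrite ger0_norm // invr_ge0.
have hA : `|u + v * w| <= 6.
  by rewrite (le_trans (add _ _ _ _ hu (mul _ _ _ _ hv hw))) // -natrM -natrD ler_nat.
have hB : `|2 * v * w + 2^-1 * u * (v ^+ 2 + w ^+ 2)| <= 16.
  have h := add _ _ _ _ (mul _ _ _ _ (mul _ _ _ _ h2 hv) hw)
    (mul _ _ _ _ (mul _ _ _ _ hi hu) (add _ _ _ _ (sq _ _ hv) (sq _ _ hw))).
  by apply: (le_trans h); rewrite mulVf ?pnatr_eq0 // mul1r -!natrX -!natrM -!natrD ler_nat.
move=> z; rewrite !inE => /or4P[] /eqP ->.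
- have h := add _ _ _ _ (add _ _ _ _ (sq _ _ hv) (mul _ _ _ _ (mul _ _ _ _ hu hv) hw))
    (sq _ _ hw).
  by apply: (le_trans h); rewrite -!natrX -!natrM -!natrD ler_nat.
- by apply: (le_trans (sq _ _ hA)); rewrite -natrX ler_nat.
- by apply: (le_trans (mul _ _ _ _ hA hB)); rewrite -natrM ler_nat.
- by apply: (le_trans (sq _ _ hB)); rewrite -natrX ler_nat.
Qed.

Lemma norm_eq1_seq4 t : prod4 t = 1 -> {in seq4 t, forall z, `|z| <= 1} ->
  {in seq4 t, forall z, `|z| = 1}.
Proof.
case: t => [[[a b] c] e] ht h.
have [ha hb hc he] : [/\ `|a| <= 1, `|b| <= 1, `|c| <= 1 & `|e| <= 1].
  by split; apply: h; rewrite !inE eqxx ?orbT.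
have eq1 (y y' : C) : `|y| <= 1 -> `|y'| <= 1 -> `|y * y'| = 1 ->
    `|y| = 1 /\ `|y'| = 1.
  rewrite normrM => hy hy' hyy.
  (* If either factor had modulus below 1, so would the product. *)
  by split; apply/eqP; rewrite eq_le ?hy ?hy' -hyy /=; [rewrite ler_piMr | rewrite ler_piMl].
have le1 (y y' : C) : `|y| <= 1 -> `|y'| <= 1 -> `|y * y'| <= 1.
  by move=> hy hy'; rewrite normrM mulr_ile1.
have := congr1 Num.norm ht; rewrite normr1 /= => hn.
have [hn1 he1] := eq1 _ _ (le1 _ _ (le1 _ _ ha hb) hc) he hn.
have [hn2 hc1] := eq1 _ _ (le1 _ _ ha hb) hc hn1.
have [ha1 hb1] := eq1 _ _ ha hb hn2.
by move=> z; rewrite !inE => /or4P[] /eqP ->.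
Qed.

End TorusParametrization.

(** * Bounded orbits, the unit circle and cosines over R[i] *)

Section RealType.
Variable R : realType.
Implicit Types z s : R[i].

(** If r = |z| > 1, Bernoulli's inequality and k <= d^k make r^(d^k) exceed k (r - 1), which is
    unbounded in the Archimedean field R. *)
Lemma normr_le1_bounded_powers (d : nat) (z N : R[i]) : (2 <= d)%N ->
  (forall k, (0 < k)%N -> `|z ^+ (d ^ k)| <= N) -> `|z| <= 1.
Proof.
move=> d2 h.
have N0 : 0 <= N by apply: le_trans (h 1%N isT).
have hN : N = (complex.Re N)%:C by rewrite RRe_real // ger0_real.
pose r := Num.sqrt (complex.Re z ^+ 2 + complex.Im z ^+ 2).
have hr : `|z| = r%:C by rewrite normc_def.
rewrite hr lecR leNgt; apply/negP => r1.
have bern n : 1 + n%:R * (r - 1) <= r ^+ n.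
  elim: n => [|n ih]; first by rewrite mul0r addr0 expr0.
  rewrite exprS -natr1.
  apply: le_trans (_ : r * (1 + n%:R * (r - 1)) <= _); last first.
    by rewrite ler_wpM2l // ltW // (lt_trans ltr01).
  rewrite -subr_ge0 (_ : _ - _ = n%:R * (r - 1) ^+ 2); last by ring.
  by rewrite mulr_ge0 // sqr_ge0.
have hk k : (0 < k)%N -> k%:R * (r - 1) < complex.Re N.
  move=> k0; have := h k k0; rewrite normrX hr -rmorphXn hN lecR => hle.
  apply: lt_le_trans hle.
  apply: lt_le_trans (_ : r ^+ k <= _).
    by apply: lt_le_trans (bern k); rewrite ltrDr ltr01.
  by apply: ler_weXn2l; [exact: ltW | exact/ltnW/ltn_expl].
have r10 : 0 < r - 1 by rewrite subr_gt0.
pose k := (Num.bound `|complex.Re N / (r - 1)|).+1.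
have := hk k isT; rewrite -ltr_pdivlMr //; apply/negP; rewrite -leNgt.
apply: (le_trans (ler_norm _)); apply: (le_trans (ltW (archi_boundP _))) => //.
by rewrite ler_nat.
Qed.

(** This is part (2) with unit complex numbers in place of angles: powers of unit numbers stay on
    the circle, which gives the converse at once through [GX_le]. *)
Lemma bounded_orbits_gdP (d : nat) (X : XQ R[i]) : (2 <= d)%N ->
  bounded_orbits (gd d) X <->
  exists s b c : R[i], [/\ `|s| = 1, `|b| = 1, `|c| = 1 &
    X = GX (s + s^-1) (b + b^-1) (c + c^-1)].
Proof.
move=> d2; rewrite bounded_orbitsP.
have neq0 (z : R[i]) : `|z| = 1 -> z != 0.
  by move=> h; rewrite -normr_eq0 h oner_neq0.
split=> [[N N1 hN]|[s [b [c [hs hb hc ->]]]]].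
  have [t ht hX] := Ftilde_esym4_surj X.
  have N41 : 1 <= 4 * N by rewrite mulr_ege1 ?ler1n.
  have ht1 : {in seq4 t, forall z, `|z| = 1}.
    apply: norm_eq1_seq4 => // z hz.
    apply: (@normr_le1_bounded_powers d _ (1 + 4 * N)) => // k k0.
    have := hN k k0; rewrite hX iter_gd_Ftilde_esym4 // /Ftilde_esym4.
    case E : (esym4 (pow4 (d ^ k) t)) => [[e1 e2] e3] /(Ftilde_M3inv_le N1)[h1 h2 h3].
    apply: (@esym4_root_le _ (pow4 (d ^ k) t)); rewrite ?E ?prod4_pow4 //.
    move: hz; case: (t) => [[[t1 t2] t3] t4].
    by rewrite !inE => /or4P[] /eqP ->; rewrite eqxx ?orbT.
  have [x [b [c [x0 b0 c0 tE]]]] := spin_torusP ht.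
  have [h1 h2 h3] : [/\ `|x * b| = 1, `|x / b| = 1 & `|c / x| = 1].
    by split; apply: ht1; rewrite tE !inE eqxx ?orbT.
  (* The unit entries are products of coordinates: x^2 is the product of the first two, after which
     b and c follow from the first and third. *)
  have hx : `|x| = 1.
    apply/eqP; rewrite -(@eqrXn2 _ 2) // expr1n -normrX.
    have -> : x ^+ 2 = (x * b) * (x / b) by rewrite mulrACA mulfV // mulr1.
    by rewrite normrM h1 h2 mulr1.
  exists (x ^+ 2), b, c; split; first by rewrite normrX hx expr1n.
  - by move: h1; rewrite normrM hx mul1r.
  - by move: h3; rewrite normrM normfV hx invr1 mulr1.
  - by rewrite GX_spin_torus // -tE.
exists 256; first by rewrite ler1n.
move=> k _.
have -> : iter k (gd d) (GX (s + s^-1) (b + b^-1) (c + c^-1)) =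
    GX (s ^+ (d ^ k) + (s ^+ (d ^ k))^-1) (b ^+ (d ^ k) + (b ^+ (d ^ k))^-1)
       (c ^+ (d ^ k) + (c ^+ (d ^ k))^-1).
  elim: k => [|k /= ->]; first by rewrite !expr1.
  by rewrite gd_GX !chebTE ?expf_neq0 ?neq0 // -!exprM -expnSr.
by apply: GX_le; apply: norm_unit_DV; rewrite normrX ?hs ?hb ?hc expr1n.
Qed.

(** On the unit circle the inverse is the conjugate, so s + s^-1 is twice the real part of s, and
    [acos] supplies the angle. *)
Lemma unit_DV_cos s : `|s| = 1 ->
  exists2 th : R, 0 <= th <= pi & s + s^-1 = (2 * cos th)%:C.
Proof.
move=> hs; have hr : -1 <= complex.Re s <= 1.
  by rewrite -ler_norml -lecR (le_trans (normc_ge_Re s)) // hs.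
have [h hc] := acos_def hr; exists (acos (complex.Re s)) => //.
rewrite hc invc_norm hs expr1n invr1 mul1r.
by case: (s) => a b /=; apply/eqP; rewrite eq_complex /= subrr mulr_natl mulr2n !eqxx.
Qed.

Lemma cos_unit_DV (th : R) : exists2 s, `|s| = 1 & (2 * cos th)%:C = s + s^-1.
Proof.
have hn : `|cos th +i* sin th : R[i]| = 1.
  by rewrite normc_def /= cos2Dsin2 sqrtr1.
exists (cos th +i* sin th)%C => //; rewrite invc_norm hn expr1n invr1 mul1r.
by apply/eqP; rewrite eq_complex /= subrr mulr_natl mulr2n !eqxx.
Qed.

End RealType.

Theorem theorem4p8 (R : realType) (d : nat) (hd : (0 < d)%N) :
  (forall u v w : R[i],
     gd d (GX u v w) = GX (chebT R[i] d).[u] (chebT R[i] d).[v] (chebT R[i] d).[w])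
  /\
  ((2 <= d)%N ->
   bounded_orbits (gd d) =
   [set X : XQ R[i] | exists alpha beta gamma : R,
      [/\ 0 <= alpha < 2 * pi, 0 <= beta < 2 * pi, 0 <= gamma < 2 * pi &
          X = GX (2 * cos (2 * alpha))%:C
                 (2 * cos (alpha + beta))%:C
                 (2 * cos gamma)%:C]]).
Proof.
split=> [u v w|d2]; first exact: gd_GX.
apply/seteqP; split=> X /=.
  move/(bounded_orbits_gdP _ d2) => [s [b [c [hs hb hc ->]]]].
  have [A /andP[A0 Api] ->] := unit_DV_cos hs.
  have [B /andP[B0 Bpi] ->] := unit_DV_cos hb.
  have [D /andP[D0 Dpi] ->] := unit_DV_cos hc.
  have pi0 := pi_gt0 R.
  (* alpha = A / 2 forces beta = B - A / 2 modulo 2 pi; as A and B lie in [0, pi], this is at least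
     - pi / 2 and one shift by 2 pi suffices. *)
  pose beta := if A / 2 <= B then B - A / 2 else B - A / 2 + 2 * pi.
  have hbeta : 0 <= beta < 2 * pi.
    rewrite /beta; case: (leP (A / 2) B) => hAB; apply/andP; split; lra.
  exists (A / 2), beta, D; split=> //; try by apply/andP; split; lra.
  have -> : 2 * (A / 2) = A by field.
  have -> // : cos (A / 2 + beta) = cos B.
  rewrite /beta; case: ifP => _; first by congr cos; ring.
  by rewrite -(cosD2pi B) -mulr_natl; congr cos; ring.
move=> [al [be [ga [_ _ _ ->]]]]; apply/(bounded_orbits_gdP _ d2).
have [s hs ->] := cos_unit_DV (2 * al); have [b hb ->] := cos_unit_DV (al + be).
have [c hc ->] := cos_unit_DV ga.
by exists s, b, c.
Qed.
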